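(* Let $n\geq 1$ and let $X=(a_0,\ldots,a_{n-1})\in(\mathbb{Z}/2\mathbb{Z})^n$ be any binary sequence, with prefix-parity sequence $P=(P_0,P_1,\ldots,P_n)$. Then \[ |D(X)|=\#\{(u,v):0\leq u<v\leq n,\ P_u\neq P_v\}. \] Consequently, if $P$ contains $z$ zeros and $n+1-z$ ones, then \[ |D(X)|=z(n+1-z). \]
   Context: For $X=(a_0,\ldots,a_{n-1})\in(\mathbb{Z}/2\mathbb{Z})^n$, the (binary) Delannoy--Steinhaus triangle $D(X)=(a_{i,j})$ is defined for $0\leq i\leq n-1$ and $0\leq j\leq n-i-1$ by $a_{0,j}=a_j$ and, in $\mathbb{Z}/2\mathbb{Z}$, \[ a_{1,j}=a_{0,j}+a_{0,j+1}\quad(0\leq j\leq n-2), \] \[ a_{i+1,j}=a_{i,j}+a_{i,j+1}+a_{i-1,j+1}\quad(1\leq i\leq n-2,\ 0\leq j\leq n-i-2). \] The weight $|D(X)|$ is the number of entries $a_{i,j}$ of the triangle (all rows, including row $0$) equal to $1$. The prefix-parity sequence of $X$ is $P=(P_0,\ldots,P_n)\in(\mathbb{Z}/2\mathbb{Z})^{n+1}$ with $P_0=0$ and $P_r=\sum_{h=0}^{r-1}a_h \pmod 2$ for $1\leq r\leq n$. *)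

(* Defs.v *)
From mathcomp Require Import all_boot all_order all_algebra.

Set Implicit Arguments.
Unset Strict Implicit.
Unset Printing Implicit Defensive.

Import GRing.Theory.
Local Open Scope ring_scope.

(* The three-term local rule reaches two rows back, hence the separate case
   for row 1.  The recursion is total on nat * nat; the entry at (i, j)
   depends only on a j, ..., a (i + j). *)
Fixpoint ds_entry (a : nat -> 'Z_2) (i j : nat) : 'Z_2 :=
  match i with
  | 0 => a j
  | i1.+1 =>
    match i1 with
    | 0 => ds_entry a i1 j + ds_entry a i1 j.+1
    | i2.+1 => ds_entry a i1 j + ds_entry a i1 j.+1 + ds_entry a i2 j.+1
    end
  end.

(* Row i of the triangle has the n - i positions j with i + j < n, so no entry
   counted in [ds_weight] sees the default value of X`_h for h >= n. *)
Definition ds_triangle (n : nat) (X : n.-tuple 'Z_2) (i j : nat) : 'Z_2 :=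
  ds_entry (fun h => X`_h) i j.

Definition ds_weight (n : nat) (X : n.-tuple 'Z_2) : nat :=
  #|[set p : 'I_n * 'I_n | (p.1 + p.2 < n)%N && (ds_triangle X p.1 p.2 == 1)]|.

Definition prefix_parity (n : nat) (X : n.-tuple 'Z_2) : n.+1.-tuple 'Z_2 :=
  [tuple \sum_(0 <= h < r) X`_h | r < n.+1].

(* Main.v *)
Require Import Defs.
From mathcomp Require Import all_boot all_order all_algebra.

Import GRing.Theory.
Local Open Scope ring_scope.

(** Writing [P r] for the sum of the first [r] entries of the sequence, the
    entry of the triangle at [(i, j)] is [P j + P (i + j + 1)], the sum of the
    [i + 1] consecutive entries starting at [j] ([ds_entry_prefix_sum]): in
    characteristic 2 the Delannoy rule telescopes, because
    [(P j + P k) + (P j' + P k') + (P j' + P k) = P j + P k'] where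
    [j' = j + 1], [k' = k + 1].  Hence the entry is 1 exactly when the prefix
    parities at [j] and [i + j + 1] differ, and [(i, j) |-> (j, i + j + 1)]
    matches the cells of the triangle with the pairs [u < v] of positions of
    the prefix-parity sequence.  The product formula then counts unordered
    pairs made of a zero and a one ([card_discordant_pairs]). *)

Lemma addrr_Z2 (x : 'Z_2) : x + x = 0.
Proof. by case: x => [[|[|?]] ?] //; apply/val_inj. Qed.

Lemma addr_eq1_Z2 (x y : 'Z_2) : (x + y == 1) = (x != y).
Proof. by case: x => [[|[|?]] ?] //; case: y => [[|[|?]] ?]. Qed.

Lemma neq_Z2 (x y : 'Z_2) : (x != y) = ((x == 0) != (y == 0)).
Proof. by case: x => [[|[|?]] ?] //; case: y => [[|[|?]] ?]. Qed.

(** The recursion looks two rows back, so two consecutive rows are carried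
    through the induction. *)
Lemma ds_entry_prefix_sum (a : nat -> 'Z_2) (i j : nat) :
  ds_entry a i j = \sum_(0 <= h < j) a h + \sum_(0 <= h < (i + j).+1) a h.
Proof.
set P := fun r => \sum_(0 <= h < r) a h; rewrite -!/(P _).
have row0 k : ds_entry a 0 k = P k + P k.+1.
  by rewrite /P big_nat_recr //= addrA addrr_Z2 add0r.
suff rows : forall k, ds_entry a i k = P k + P (i + k).+1 /\
    ds_entry a i.+1 k = P k + P (i.+1 + k).+1 by have [] := rows j.
elim: i => [|i IH] k.
  split; first exact: row0.
  rewrite -[ds_entry a 1 k]/(ds_entry a 0 k + ds_entry a 0 k.+1) !row0.
  by rewrite addrA -(addrA (P k)) addrr_Z2 addr0.
have [_ Ek] := IH k; have [Ek' Ek1] := IH k.+1.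
split=> //.
rewrite -[ds_entry a i.+2 k]/(ds_entry a i.+1 k + ds_entry a i.+1 k.+1
  + ds_entry a i k.+1) Ek Ek1 Ek' !addnS !addSn.
set q := P (i + k).+2; set s := P _.+3.
rewrite (addrC (P k.+1) s) -!addrA (addrA (P k.+1)) addrr_Z2 add0r.
by rewrite (addrC s) addrA addrA -(addrA (P k)) addrr_Z2 addr0.
Qed.

(** Sorting a pair whose first component satisfies [b] and whose second does
    not is a bijection onto the increasing pairs on which [b] takes both
    values; it is realised by splitting according to which of the two comes
    first and swapping the components in one of the cases. *)
Lemma card_discordant_pairs (m : nat) (b : pred 'I_m) :
  #|[set uv : 'I_m * 'I_m | (uv.1 < uv.2)%N && (b uv.1 != b uv.2)]| =
  (#|b| * #|predC b|)%N.
Proof.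
rewrite -cardX.
pose lt := [set uv : 'I_m * 'I_m | (uv.1 < uv.2)%N].
pose swap (uv : 'I_m * 'I_m) := (uv.2, uv.1).
have swapK : involutive swap by case.
pose B := [set uv : 'I_m * 'I_m | b uv.1 && ~~ b uv.2].
have -> : #|predX b (predC b)| = #|B|.
  by apply: eq_card => uv; rewrite !inE.
rewrite -(cardsID lt B) -(card_imset (B :\: lt) (inv_inj swapK)).
have -> : swap @: (B :\: lt) =
    [set uv in lt | ~~ b uv.1 && b uv.2].
  apply/setP=> -[u v]; rewrite (can2_imset_pre _ swapK swapK) !inE /=.
  case: (ltngtP u v) => [_ | _ | /val_inj ->] //=; first by rewrite andbC.
  by case: (b v).
rewrite -(cardsID [set uv | b uv.1]); congr (_ + _)%N;
  apply: eq_card => uv; rewrite !inE;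
  by case: (_ < _)%N; case: (b uv.1); case: (b uv.2).
Qed.

Lemma card_tnth_eq (T : eqType) (m : nat) (t : m.-tuple T) (x : T) :
  #|[pred u | tnth t u == x]| = count_mem x t.
Proof. by rewrite -sum1_card -sum1_count big_tuple. Qed.

Lemma tnth_prefix_parity (n : nat) (X : n.-tuple 'Z_2) (u : 'I_n.+1) :
  tnth (prefix_parity X) u = \sum_(0 <= h < u) X`_h.
Proof. by rewrite tnth_mktuple. Qed.

(** Reindexing along [(i, j) |-> (j, i + j + 1)], whose image is all pairs
    [u < v <= n]. *)
Lemma ds_weight_discordant (n : nat) (X : n.-tuple 'Z_2) :
  ds_weight X =
    #|[set uv : 'I_n.+1 * 'I_n.+1 |
        (uv.1 < uv.2)%N &&
        (tnth (prefix_parity X) uv.1 != tnth (prefix_parity X) uv.2)]|.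
Proof.
rewrite /ds_weight.
pose f (p : 'I_n * 'I_n) : 'I_n.+1 * 'I_n.+1 :=
  (inord p.2, inord (p.1 + p.2).+1).
set A := [set p | _].
have inordE (p : 'I_n * 'I_n) : (p.1 + p.2 < n)%N ->
    (inord p.2 : 'I_n.+1) = p.2 :> nat /\
    (inord (p.1 + p.2).+1 : 'I_n.+1) = (p.1 + p.2).+1 :> nat.
  by move=> lt_n; split; apply: inordK; rewrite ?ltnS // ltnW.
have f_inj : {in A &, injective f}.
  move=> [i j] [i' j']; rewrite !inE /= => /andP[/(inordE (i, j))/= [Ej Ek] _].
  move=> /andP[/(inordE (i', j'))/= [Ej' Ek'] _] [/(congr1 val)/= Hj].
  move=> /(congr1 val)/=; rewrite Ek Ek' => -[].
  by move: Hj; rewrite Ej Ej' => /val_inj -> /addIn /val_inj ->.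
rewrite -(card_in_imset f_inj); apply: eq_card => -[u v].
rewrite [RHS]inE /= !tnth_prefix_parity; apply/imsetP/andP.
  case=> -[i j]; rewrite inE /= => /andP[/(inordE (i, j))/= [Ej Ek]].
  rewrite /ds_triangle ds_entry_prefix_sum addr_eq1_Z2 => neq [-> ->] /=.
  by rewrite Ej Ek ltnS leq_addl.
case=> lt_uv neq; have le_vn : (v <= n)%N by rewrite -ltnS.
have lt_un : (u < n)%N := leq_trans lt_uv le_vn.
have lt_dn : (v - u.+1 < n)%N.
  by rewrite (leq_trans _ le_vn) // ltn_subrL (leq_trans _ lt_uv).
have Ev : (v - u.+1 + u).+1 = v by rewrite -addnS subnK.
exists (Ordinal lt_dn, Ordinal lt_un).
  by rewrite inE /= /ds_triangle ds_entry_prefix_sum addr_eq1_Z2 Ev neq le_vn.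
by rewrite /f /= Ev !inord_val.
Qed.

Theorem proposition3p2 (n : nat) (hn : (1 <= n)%N) (X : n.-tuple 'Z_2) :
  ds_weight X =
    #|[set uv : 'I_n.+1 * 'I_n.+1 |
        (uv.1 < uv.2)%N &&
        (tnth (prefix_parity X) uv.1 != tnth (prefix_parity X) uv.2)]|
  /\
  (forall z : nat,
     count_mem (0 : 'Z_2) (prefix_parity X) = z ->
     count_mem (1 : 'Z_2) (prefix_parity X) = (n.+1 - z)%N ->
     ds_weight X = (z * (n.+1 - z))%N).
Proof.
split=> [|z Ez E1]; first exact: ds_weight_discordant.
rewrite -E1 -Ez ds_weight_discordant -!card_tnth_eq.
set P := prefix_parity X.
have <- : #|predC [pred u | tnth P u == 0]| = #|[pred u | tnth P u == 1]|.
  by apply: eq_card => u; rewrite !inE -addr_eq1_Z2 addr0.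
rewrite -card_discordant_pairs; apply: eq_card => uv.
by rewrite !inE -neq_Z2.
Qed.
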